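(* Suppose the following statement (Gvözdjak's Conjecture) holds: for every positive integer $n$ and all integers $x\neq y$ with $0\le x,y\le n-1$ such that $|x-y|\equiv\lfloor n/2\rfloor \pmod 2$, $|x-y|\le n/2$ and $(n-1)/2\le x+y\le (3n-3)/2$, there is a graceful permutation of length $n$ with first element $x$ and last element $y$. Then for every positive integer $\ell$ and every $S\subseteq D_{8\ell+2}\setminus\{e\}$ with $|S|=8\ell$, the group $D_{8\ell+2}$ has an $S$-sequencing.
   Context: $D_{2m}=\langle u,v : u^m=e=v^2,\ vu=u^{m-1}v\rangle$ is the dihedral group of order $2m$. A graceful permutation of length $n$ is an arrangement $(a_1,\dots,a_n)$ of $\{0,1,\dots,n-1\}$ whose absolute differences $|a_{i+1}-a_i|$ ($1\le i\le n-1$) are exactly $\{1,\dots,n-1\}$. For $S\subseteq G\setminus\{e\}$ with $|S|=k$, an $S$-sequencing of $G$ is an ordering $(g_1,\dots,g_k)$ of the elements of $S$ such that the partial products $h_0=e$, $h_i=g_1\cdots g_i$ are pairwise distinct. *)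

(* Defs.v *)
From mathcomp Require Import all_boot all_order all_fingroup all_solvable.
Set Implicit Arguments. Unset Strict Implicit. Unset Printing Implicit Defensive.

Definition absdiff (a b : nat) : nat := (a - b) + (b - a).

Definition consec_diffs (s : seq nat) : seq nat :=
  [seq absdiff p.2 p.1 | p <- zip s (behead s)].

Definition graceful_perm (n : nat) (s : seq nat) : bool :=
  perm_eq s (iota 0 n) && perm_eq (consec_diffs s) (iota 1 n.-1).

Definition gvozdjak_conjecture : Prop :=
  forall n x y : nat, 0 < n -> x != y -> x < n -> y < n ->
    absdiff x y = n./2 %[mod 2] ->
    (absdiff x y).*2 <= n ->
    n - 1 <= (x + y).*2 -> (x + y).*2 <= 3 * n - 3 ->
    exists s : seq nat, [/\ graceful_perm n s, head 0 s = x & last 0 s = y].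

Definition partial_prods (gT : finGroupType) (s : seq gT) : seq gT :=
  [seq (\prod_(g <- take i s) g)%g | i <- iota 0 (size s).+1].

Definition S_sequencing (gT : finGroupType) (S : {set gT}) (s : seq gT) : bool :=
  perm_eq s (enum S) && uniq (partial_prods s).

(* Main.v *)
(* A sequencing is a path through the group whose successive quotients g^-1 h are distinct. With
   m = 4l + 1 split the group into rotations u^a and reflections u^b v: a step between the two kinds
   has quotient u^(b-a) v, a step inside one kind has quotient u^(+-(difference)), with opposite signs
   for the two kinds. A graceful permutation s of length 2l + 1 traversed once among the rotations and
   once among the reflections therefore uses every nontrivial rotation once, and zigzags between the
   2l remaining rotations and the 2l remaining reflections have consecutive exponents as quotients.
   If the missing element is a reflection, the path is zigzag, s, s, zigzag, with the ends of s chosen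
   so that the connecting steps have the exponents left free by the zigzags.
   If the missing element is u^d, cut s = s1 s2 at its unique edge of difference d and exchange tails:
   s1 among rotations followed by s2 among reflections, and conversely. The ends do not change, the two
   edges of difference d become reflections with exponents +-d, and one edge of difference d is put back
   between two zigzags. This is done for even d < 2l and for 3d = m; replacing u by a power of u
   (d -> 2d and d -> m - d) reduces all other d to these, up to two small cases. *)
Require Import Defs.
From mathcomp Require Import all_boot all_order all_fingroup all_solvable.
From mathcomp Require Import zify.
Set Implicit Arguments. Unset Strict Implicit. Unset Printing Implicit Defensive.

(** * Zigzags and quotients *)

(* [(false, a)] stands for [u ^+ a] and [(true, b)] for [u ^+ (b + 2 * l) * v]. The shift by [2 * l]
   makes the exponents [b + 2 * l - a] of the crossing steps below lie in [0, 4 * l], without wraparound. *)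
Definition pos (l : nat) (p : bool * nat) : nat := p.2 + p.1 * (2 * l).

(* The pair [(t, c)] encodes the quotient [u ^+ c * v ^+ t], here without the shift. *)
Definition quot (l : nat) (p q : bool * nat) : bool * nat :=
  (p.1 (+) q.1,
   (if p.1 then pos l p + 2 * (4 * l + 1) - pos l q
    else pos l q + 2 * (4 * l + 1) - pos l p) %% (4 * l + 1)).

Definition quots l (s : seq (bool * nat)) : seq (bool * nat) :=
  if s is p :: s' then pairmap (quot l) p s' else [::].

Fixpoint zig (t : bool) (a b n : nat) : seq (bool * nat) :=
  if n is n'.+1 then
    (t, if t then b else a) :: (if t then zig false a b.-1 n' else zig true a.+1 b n')
  else [::].

Lemma quots_cat l s1 s2 : s1 != [::] -> s2 != [::] ->
  quots l (s1 ++ s2) = quots l s1 ++ quot l (last (false, 0) s1) (head (false, 0) s2) :: quots l s2.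
Proof. by case: s1 => // p s1 _; case: s2 => // q s2 _; rewrite /= pairmap_cat. Qed.

Lemma quot_cross l a b : a <= b + 2 * l -> b + 2 * l - a <= 4 * l ->
  quot l (false, a) (true, b) = (true, b + 2 * l - a).
Proof.
move=> h1 h2; rewrite /quot /pos /=; congr (_, _).
by rewrite (_ : _ - _ = (b + 2 * l - a) + 2 * (4 * l + 1)) ?modnMDl; [rewrite addnC modnMDl modn_small|]; lia.
Qed.

Lemma quot_crossC l a b : quot l (true, b) (false, a) = quot l (false, a) (true, b).
Proof. by []. Qed.

Lemma size_zig t a b n : size (zig t a b n) = n.
Proof. by elim: n t a b => //= n IHn [] a b /=; rewrite IHn. Qed.

Lemma head_zig v t a b n : head v (zig t a b n.+1) = (t, if t then b else a).
Proof. by []. Qed.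

Lemma last_zig v t a b n :
  last v (zig t a b n.+1) =
    if t (+) odd n then (true, b - n./2) else (false, a + n./2).
Proof.
elim: n v t a b => [|n IHn] v t a b.
  by rewrite /= subn0 addn0; case: t.
rewrite [zig _ _ _ _.+2]/= -/(zig _ _ _ _.+1).
case: t; rewrite last_cons IHn /= ?negbK ?uphalf_half; case: (boolP (odd n)) => hn /=; congr (_, _); lia.
Qed.

(** * Vertices and quotients of a zigzag *)

Lemma count_zigA t a b n v :
  count_mem (false, v) (zig t a b n) = (a <= v < a + (n + ~~ t)./2) :> nat.
Proof.
elim: n t a b => [|n IHn] [] a b /=; rewrite ?IHn ?xpair_eqE /=; lia.
Qed.

(** The bound on [b] keeps the truncated [b.-1] from repeating the value [0]. *)
Lemma count_zigB (t : bool) a b n v : (n + t)./2 <= b.+1 ->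
  count_mem (true, v) (zig t a b n) = (v <= b < v + (n + t)./2) :> nat.
Proof.
elim: n t a b => [|n IHn] [] a b hb /=; rewrite ?IHn ?xpair_eqE /=; lia.
Qed.

(** Each step of a zigzag either raises [a] or lowers [b] by one, so the exponents run down
    consecutively from [b + 2 * l - a]. *)
Lemma count_quots_zig l t a b n c :
  n <= b -> a + n <= b + 2 * l -> b + 2 * l - a <= 4 * l ->
  count_mem (true, c) (quots l (zig t a b n.+1)) = (c + a <= b + 2 * l < c + a + n) :> nat.
Proof.
elim: n t a b => [|n IHn] t a b h0 h1 h2; first by case: t => /=; lia.
case: t; rewrite [zig _ _ _ _.+2]/= -/(zig _ _ _ _.+1).
all: rewrite -cat1s quots_cat // head_zig /= ?quot_crossC quot_cross; try lia.
all: rewrite xpair_eqE /= -/(zig _ _ _ _.+1) IHn; lia.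
Qed.

#[global] Arguments zig : simpl never.

Lemma head_catl (T : eqType) (v : T) s1 s2 : s1 != [::] -> head v (s1 ++ s2) = head v s1.
Proof. by case: s1. Qed.

(** Distinctness of the reflection quotients is checked this way: a zigzag contributes an interval
    of exponents, a connecting step a singleton. *)
Lemma sum_disjoint_intervals N c (L : seq (nat * nat)) :
  pairwise (fun p q => (p.2 <= q.1) || (q.2 <= p.1)) L -> all (fun p => p.2 <= N) L ->
  \sum_(p <- L) (p.1 <= c < p.2) <= (c < N).
Proof.
elim: L => [|p L IHL]; first by rewrite big_nil.
rewrite big_cons pairwise_cons => /andP[/allP pL /IHL {}IHL] /andP[pN /IHL {}IHL].
case: (boolP (p.1 <= c < p.2)) => [cp|_] //.
rewrite big1_seq ?addn0; first lia.
by move=> q /andP[_ /pL]; lia.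
Qed.

(* [L] must list the intervals in the order of the summands of the goal. *)
Ltac disjoint_intervals L :=
  refine (@leq_trans _ _ _ _ (@sum_disjoint_intervals _ _ L _ _));
  [ rewrite !big_cons big_nil addn0 -!addnA eq_leq //; do ?congr (_ + _); rewrite /=; lia
  | rewrite /= ?andbT; do ![apply/andP; split]; lia
  | rewrite /= ?andbT; do ![apply/andP; split]; lia ].

(** * Reversal of alternating paths *)

Definition alternating (s : seq (bool * nat)) := sorted (fun p q => p.1 != q.1) s.

(** The quotient of a crossing step is a reflection, hence its own inverse; zigzags can thus be run
    backwards. *)
Lemma quotC l p q : p.1 != q.1 -> quot l p q = quot l q p.
Proof. by case: p q => [[] a] [[] b]. Qed.

Lemma quots_rev l s : alternating s -> quots l (rev s) = rev (quots l s).
Proof.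
case: s => // p s; elim: s p => // q s IHs p /andP[npq hs].
rewrite rev_cons -cats1 quots_cat //; last by rewrite -size_eq0 size_rev.
by rewrite IHs // rev_cons last_rcons quotC 1?eq_sym // cats1 -rev_cons.
Qed.

Lemma count_quots_alternating l s c : alternating s -> count_mem (false, c) (quots l s) = 0.
Proof.
case: s => // p s; elim: s p => // q s IHs p /= /andP[npq /IHs ->].
by case: p q npq => [[] a] [[] b].
Qed.

Lemma alternating_zig t a b n : alternating (zig t a b n).
Proof.
case: n => // n; elim: n t a b => [|n IHn] [] a b //.
  by have := IHn false a b.-1.
by have := IHn true a.+1 b.
Qed.

Lemma count_quots_zig_rot l t a b n c : count_mem (false, c) (quots l (zig t a b n)) = 0.
Proof. by rewrite count_quots_alternating ?alternating_zig. Qed.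

Lemma count_quots_rev l s p : alternating s ->
  count_mem p (quots l (rev s)) = count_mem p (quots l s).
Proof. by move=> hs; rewrite quots_rev // count_rev. Qed.

Lemma count_mem_cons (T : eqType) (x y : T) s : count_mem x (y :: s) = (y == x) + count_mem x s.
Proof. by []. Qed.

(** * Copies of a graceful permutation *)

Lemma count_pair (t : bool) (v : nat) s : count_mem (t, v) (map (pair t) s) = count_mem v s.
Proof. by elim: s => //= w s ->; rewrite xpair_eqE eqxx. Qed.

Lemma count_pairN (t u : bool) (v : nat) s : t != u -> count_mem (t, v) (map (pair u) s) = 0.
Proof. by case: t u => [] [] // _; elim: s. Qed.

Lemma head_pair v (t : bool) s : s != [::] -> head v (map (pair t) s) = (t, head 0 s).
Proof. by case: s. Qed.

Lemma last_pair v (t : bool) s : s != [::] -> last v (map (pair t) s) = (t, last 0 s).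
Proof. by case: s => // x s _; rewrite /= last_map. Qed.

Lemma count_quots_pair l (t : bool) c s : count_mem (true, c) (quots l (map (pair t) s)) = 0.
Proof. by case: t; case: s => // x s; elim: s x => // y s IHs x; rewrite /= IHs. Qed.

Lemma consec_diffs_cons x y s :
  consec_diffs [:: x, y & s] = absdiff y x :: consec_diffs (y :: s).
Proof. by []. Qed.

Lemma consec_diffs_cat s1 s2 : s1 != [::] -> s2 != [::] ->
  consec_diffs (s1 ++ s2) =
    consec_diffs s1 ++ absdiff (head 0 s2) (last 0 s1) :: consec_diffs s2.
Proof.
case: s1 => // x s1 _; case: s2 => // y s2 _.
by elim: s1 x => // z s1 IHs x; rewrite !cat_cons !consec_diffs_cons -cat_cons IHs.
Qed.

(* The same step has opposite quotients in the two copies of [s]. *)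
Lemma count_quots_pairs l c s : 0 < c < 4 * l + 1 -> all (fun v => v <= 4 * l) s ->
  count_mem (false, c) (quots l (map (pair false) s))
    + count_mem (false, c) (quots l (map (pair true) s))
  = count_mem c (consec_diffs s) + count_mem (4 * l + 1 - c) (consec_diffs s).
Proof.
move=> hc; case: s => // x s; elim: s x => // y s IHs x hs.
have /andP[hx /andP[hy _]] := hs.
rewrite consec_diffs_cons /= -/(consec_diffs _) !xpair_eqE /=.
have := IHs y (proj2 (andP hs)); rewrite /= => h.
have modE u v : u <= 4 * l -> v <= 4 * l ->
    (u + 2 * (4 * l + 1) - v) %% (4 * l + 1) = if v <= u then u - v else u + (4 * l + 1) - v.
  move=> hu hv; case: leqP => huv.
    by rewrite (_ : _ - _ = 2 * (4 * l + 1) + (u - v)) ?modnMDl ?modn_small; lia.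
  by rewrite (_ : _ - _ = 1 * (4 * l + 1) + (u + (4 * l + 1) - v)) ?modnMDl ?modn_small; lia.
rewrite /pos /= !mul0n !mul1n !addn0.
rewrite (_ : x + 2 * l + _ - (y + _) = x + 2 * (4 * l + 1) - y); last lia.
rewrite !modE // /absdiff; move: h.
set A := count_mem _ _; set B := count_mem _ _; set C := count_mem _ _; set D := count_mem _ _.
move=> h; case: leqP => h1; case: leqP => h2; lia.
Qed.

Lemma diff_split s d : d \in consec_diffs s ->
  exists s1 s2, [/\ s = s1 ++ s2, s1 != [::], s2 != [::] & absdiff (head 0 s2) (last 0 s1) = d].
Proof.
case: s => // x s; elim: s x => // y s IHs x; rewrite consec_diffs_cons inE => /orP[/eqP->|].
  by exists [:: x], (y :: s).
by case/IHs=> [s1 [s2 [-> n1 n2 e]]]; exists (x :: s1), s2; split=> //; case: s1 n1 e.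
Qed.

Lemma gracefulP n s : graceful_perm n s ->
  [/\ size s = n, all (fun v => v < n) s, forall v, count_mem v s = (v < n)
    & forall c, count_mem c (consec_diffs s) = (0 < c < n)].
Proof.
have cnt a b v : count_mem v (iota a b) = (a <= v < a + b).
  by rewrite count_uniq_mem ?iota_uniq // mem_iota.
case/andP=> h1 h2; split.
- by rewrite (perm_size h1) size_iota.
- by rewrite (perm_all _ h1); apply/allP=> v; rewrite mem_iota.
- by move=> v; rewrite (seq.permP h1) cnt.
- by move=> c; rewrite (seq.permP h2) cnt; lia.
Qed.

(* [x] encodes the nontrivial element that is left out. *)
Definition good_path l (s : seq (bool * nat)) (x : bool * nat) :=
  [/\ size s = (8 * l + 1)%N, forall t v, count_mem (t, v) s <= (v < 4 * l + 1)
    & forall t c, c <= 4 * l -> t || (0 < c) -> count_mem (t, c) (x :: quots l s) <= 1].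


(** * Paths with a prescribed omitted element *)

Lemma gvozdjak_ends l x y : gvozdjak_conjecture -> x != y -> x <= 2 * l -> y <= 2 * l ->
  odd (absdiff x y) = odd l -> absdiff x y <= l -> l <= x + y <= 3 * l ->
  exists s, [/\ graceful_perm (2 * l + 1) s, head 0 s = x & last 0 s = y].
Proof.
move=> gv nxy hx hy ho hd hxy; apply: gv => //; rewrite /absdiff in ho hd *; try lia.
Qed.

Lemma good_path_reflection l : gvozdjak_conjecture -> 0 < l ->
  exists s, good_path l s (true, 1).
Proof.
(* The distance from [x] to [l + 1] is 1 or 2, with the parity of [l]. *)
move=> gv l0; have [x xE] : {x | x = l - ~~ odd l} by eexists.
have [s [gs hx hy]] : exists s, [/\ graceful_perm (2 * l + 1) s, head 0 s = x & last 0 s = l.+1].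
  by apply: (gvozdjak_ends gv); rewrite /absdiff; lia.
have [sz sb sc sd] := gracefulP gs.
have s0 : s != [::] by rewrite -size_eq0 sz addn1.
(* The starting kind makes the first zigzag end at the rotation [x + 2 * l], so the link to
   [(true, x)] has exponent 0. *)
exists (zig (~~ odd l) (2 * l + 1) (4 * l) (x + l - 2).+1 ++ map (pair true) s ++ map (pair false) s
  ++ zig true (2 * l + x + 1) (3 * l + 1) (3 * l - x - 1).+1).
have np t : map (pair t) s != [::] by rewrite -size_eq0 size_map size_eq0.
split.
- rewrite !size_cat !size_zig !size_map sz; lia.
- move=> [] v; rewrite !count_cat !count_pair !count_pairN // sc.
    by rewrite !count_zigB; lia.
  by rewrite !count_zigA; lia.
- have hs : all (fun v => v <= 4 * l) s by apply: sub_all sb => v /=; lia.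
  move=> t c hc tc; rewrite !quots_cat ?np //; try by case: (s) s0.
  rewrite !head_catl ?np // !head_pair // !last_pair // last_zig head_zig hx hy.
  rewrite (_ : (_ (+) _) = false); last lia.
  rewrite !quot_crossC !quot_cross; [|lia ..].
  rewrite !(count_cat, count_mem_cons).
  case: t tc => [_|c0].
    apply: leq_trans (leq_b1 (c < 4 * l + 1)).
    rewrite !count_quots_zig ?count_quots_pair ?add0n; [|lia ..].
    rewrite !xpair_eqE /=.
    (* In order: omitted reflection, first zigzag, link, link between the copies, link, last zigzag.
       They tile [0..4l]. *)
    disjoint_intervals [:: (1, 2); (3 * l + 2 - x, 4 * l); (0, 1); (3 * l + 1 - x, 3 * l + 2 - x);
      (4 * l, 4 * l + 1); (2, 3 * l + 1 - x)].
  rewrite !count_quots_zig_rot; have := count_quots_pairs (l := l) (c := c) (s := s) _ hs.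
  by rewrite !sd !xpair_eqE /=; lia.
Qed.

(* [d] occurs exactly once among the differences of [s]; cutting there and exchanging the tails of the
   two copies turns the two quotients [+-d] into reflections and keeps the endpoints of [s]. *)
Lemma graceful_split l s x y d : graceful_perm (2 * l + 1) s -> head 0 s = x -> last 0 s = y ->
  0 < d <= 2 * l ->
  exists s1 s2,
    [/\ s1 != [::], s2 != [::], head 0 s1 = x & last 0 s2 = y]
    /\ [/\ size s1 + size s2 = 2 * l + 1,
         forall v, count_mem v s1 + count_mem v s2 = (v < 2 * l + 1),
         last 0 s1 <= 2 * l, head 0 s2 <= 2 * l & absdiff (head 0 s2) (last 0 s1) = d]
    /\ forall c, 0 < c <= 4 * l ->
         count_mem (false, c) (quots l (map (pair false) s1))
         + count_mem (false, c) (quots l (map (pair true) s1))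
         + (count_mem (false, c) (quots l (map (pair false) s2))
            + count_mem (false, c) (quots l (map (pair true) s2)))
         + (c == d) + (c == 4 * l + 1 - d) = 1.
Proof.
move=> gs hx hy hd; have [sz sb sc sd] := gracefulP gs.
have dD : d \in consec_diffs s by rewrite -has_pred1 has_count sd; lia.
have [s1 [s2 [sE n1 n2 e]]] := diff_split dD; exists s1, s2.
have hall : all (fun v => v <= 4 * l) s by apply: sub_all sb => v /=; lia.
move: hall sb; rewrite sE !all_cat => /andP[a1 a2] /andP[b1 b2].
have in1 : last 0 s1 \in s1 by case: (s1) n1 => // a r _; apply: mem_last.
have in2 : head 0 s2 \in s2 by case: (s2) n2 => // a r _; apply: mem_head.
split; [|split].
- by split=> //; [rewrite -hx sE head_catl|rewrite -hy sE last_cat; case: (s2) n2].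
- split=> //; first by rewrite -size_cat -sE.
  + by move=> v; rewrite -count_cat -sE.
  + by have := allP b1 _ in1; lia.
  + by have := allP b2 _ in2; lia.
- move=> c hc; rewrite !count_quots_pairs //; try lia.
  move: (sd c) (sd (4 * l + 1 - c)); rewrite sE consec_diffs_cat // e !count_cat !count_mem_cons.
  by lia.
Qed.

Lemma quot_reflections l b b' : b <= 4 * l -> b' <= 4 * l ->
  quot l (true, b) (true, b') = (false, if b' <= b then b - b' else b + (4 * l + 1) - b').
Proof.
move=> hb hb'; rewrite /quot /pos /=; congr (_, _); case: leqP => h.
  by rewrite (_ : _ - _ = 2 * (4 * l + 1) + (b - b')) ?modnMDl ?modn_small; lia.
by rewrite (_ : _ - _ = 1 * (4 * l + 1) + (b + (4 * l + 1) - b')) ?modnMDl ?modn_small; lia.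
Qed.

Lemma cat_neq0 (T : eqType) (s1 s2 : seq T) : s1 != [::] -> s1 ++ s2 != [::].
Proof. by case: s1. Qed.

Lemma pair_neq0 (t : bool) (s : seq nat) : s != [::] -> map (pair t) s != [::].
Proof. by case: s. Qed.

Lemma rev_neq0 (T : eqType) (s : seq T) : s != [::] -> rev s != [::].
Proof. by rewrite -!size_eq0 size_rev. Qed.

Lemma head_rev (T : Type) (v : T) s : head v (rev s) = last v s.
Proof. by case/lastP: s => // s x; rewrite rev_rcons last_rcons. Qed.

Lemma last_rev (T : Type) (v : T) s : last v (rev s) = head v s.
Proof. by case: s => // x s; rewrite rev_cons last_rcons. Qed.

(** The exchanged edges have exponents [2l - 2k] and [2l + 2k], the two gaps left by the zigzags and
    links. The link from [rev z2] to [z4] joins two reflections and restores the quotient [2k], so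
    [4l + 1 - 2k] is omitted. *)
Lemma good_path_even l k : gvozdjak_conjecture -> 0 < k < l ->
  exists s, good_path l s (false, 4 * l + 1 - 2 * k).
Proof.
move=> gv kl.
have [s [gs hx hy]] : exists s, [/\ graceful_perm (2 * l + 1) s, head 0 s = 1 & last 0 s = l.+1].
  by apply: (gvozdjak_ends gv); rewrite /absdiff; lia.
have [|s1 [s2 [[n1 n2 h1 h2] [[sz sc i1 i2 e] sq]]]] := graceful_split (d := 2 * k) gs hx hy; first lia.
have [h hE] : {h | l = k + h} by exists (l - k); lia.
(* [X] runs from rotation [1] to reflection [l + 1], [Y] from reflection [1] to rotation [l + 1]. *)
pose X := map (pair false) s1 ++ map (pair true) s2.
pose Y := map (pair true) s1 ++ map (pair false) s2.
pose z1 := zig false (2 * l + 1) (4 * l) (2 * h - 1).+1.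
pose z2 := zig true (2 * l + h + 1) (4 * l - h) (2 * k - 2).+1.
pose z3 := zig false (3 * l) (3 * l) (2 * k).+1.
pose z4 := zig true (4 * l - h + 1) (2 * l + h) (2 * h - 2).+1.
exists (rev z2 ++ z4 ++ X ++ z3 ++ rev z1 ++ Y).
have [nz1 nz2 nz3 nz4] : [/\ z1 != [::], z2 != [::], z3 != [::] & z4 != [::]] by [].
have nX : X != [::] by rewrite cat_neq0 ?pair_neq0.
have nY : Y != [::] by rewrite cat_neq0 ?pair_neq0.
split.
- rewrite /X /Y /z1 /z2 /z3 /z4 !size_cat !size_rev !size_zig !size_map; lia.
- move=> t v; have := sc v.
  rewrite /X /Y /z1 /z2 /z3 /z4 !(count_cat, count_rev); clear -kl hE sz.
  case: t; rewrite !count_pair !count_pairN //.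
    by rewrite !count_zigB; lia.
  by rewrite !count_zigA; lia.
- move=> t c hc tc.
  have [nr1 nr2] : rev z1 != [::] /\ rev z2 != [::] by rewrite !rev_neq0.
  rewrite (quots_cat l nr2 (cat_neq0 _ nz4)) (quots_cat l nz4 (cat_neq0 _ nX)).
  rewrite (quots_cat l nX (cat_neq0 _ nz3)) (quots_cat l nz3 (cat_neq0 _ nr1)) (quots_cat l nr1 nY).
  rewrite /X /Y !quots_cat ?pair_neq0 // !head_catl ?pair_neq0 // !head_rev !last_rev !last_cat.
  rewrite !head_pair // !last_pair // h1 h2 /z1 /z2 /z3 /z4 !head_zig !last_zig.
  clear X Y z1 z2 z3 z4 nX nY nz1 nz2 nz3 nz4 nr1 nr2.
  have -> : true (+) odd (2 * h - 2) = true by lia.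
  have -> : false (+) odd (2 * h - 1) = true by lia.
  have -> : false (+) odd (2 * k) = false by lia.
  rewrite !quot_crossC !quot_cross ?quot_reflections; [|lia ..].
  (* No wraparound: the link between reflections has quotient [(4l - h) - (2l + h) = 2k]. *)
  have -> : 2 * l + h <= 4 * l - h by lia.
  rewrite !(count_cat, count_mem_cons) !count_quots_rev ?alternating_zig //.
  case: t tc => [_|c0].
    rewrite !count_quots_zig ?count_quots_pair ?add0n; [|lia ..].
    rewrite !xpair_eqE.
    apply: leq_trans (leq_b1 (c < 4 * l + 1)).
    rewrite /absdiff in e; rewrite eqxx !andTb ?addn0 {sc sq}.
    disjoint_intervals [:: (2 * l + 2, 2 * l + 2 * k); (2, 2 * h); (4 * l, (4 * l).+1);
      (head 0 s2 + 2 * l - last 0 s1, (head 0 s2 + 2 * l - last 0 s1).+1); (1, 2);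
      (2 * l + 1 - 2 * k, 2 * l + 1); (2 * l + 1, 2 * l + 2); (2 * l + 2 * k + 1, 4 * l); (0, 1);
      (last 0 s1 + 2 * l - head 0 s2, (last 0 s1 + 2 * l - head 0 s2).+1)].
  rewrite !count_quots_zig_rot.
  by rewrite !xpair_eqE; have := sq c; move: c0 hc => /= c0 hc; lia.
Qed.

(** Here [4j + 3] is a third of [m = 4l + 1], a fixed point of [d -> m - 2d]. The long zigzag [z3]
    takes the exponents at distance at most [4j + 2] from [2l]; the exchanged edges flank them at
    [2l - d] and [2l + d]. *)
Lemma good_path_third l j : gvozdjak_conjecture -> l = 3 * j + 2 -> 0 < j ->
  exists s, good_path l s (false, 4 * j + 3).
Proof.
move=> gv lj j0.
have [s [gs hx hy]] : exists s, [/\ graceful_perm (2 * l + 1) s, head 0 s = 1 & last 0 s = l.-1].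
  by apply: (gvozdjak_ends gv); rewrite /absdiff; lia.
have [|s1 [s2 [[n1 n2 h1 h2] [[sz sc i1 i2 e] sq]]]] := graceful_split (d := 4 * j + 3) gs hx hy; first lia.
pose X := map (pair false) s1 ++ map (pair true) s2.
pose Y := map (pair true) s1 ++ map (pair false) s2.
pose z1 := zig false (2 * l + 1) (4 * l) (2 * j - 1).+1.
pose z3 := zig false (2 * l + j + 2) (4 * l - j) (8 * j + 5).+1.
pose z4 := zig true (4 * l + 1 - j) (2 * l + j + 1) (2 * j).+1.
exists (z3 ++ rev z1 ++ Y ++ z4 ++ X).
have [nz1 nz3 nz4] : [/\ z1 != [::], z3 != [::] & z4 != [::]] by [].
have nX : X != [::] by rewrite cat_neq0 ?pair_neq0.
have nY : Y != [::] by rewrite cat_neq0 ?pair_neq0.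
split.
- rewrite /X /Y /z1 /z3 /z4 !size_cat !size_rev !size_zig !size_map; lia.
- move=> t v; have := sc v.
  rewrite /X /Y /z1 /z3 /z4 !(count_cat, count_rev); clear -lj j0 sz.
  case: t; rewrite !count_pair !count_pairN //.
    by rewrite !count_zigB; lia.
  by rewrite !count_zigA; lia.
- move=> t c hc tc.
  have nr1 : rev z1 != [::] by rewrite rev_neq0.
  rewrite (quots_cat l nz3 (cat_neq0 _ nr1)) (quots_cat l nr1 (cat_neq0 _ nY)).
  rewrite (quots_cat l nY (cat_neq0 _ nz4)) (quots_cat l nz4 nX).
  rewrite /X /Y !quots_cat ?pair_neq0 // !head_catl ?pair_neq0 // !head_rev !last_rev !last_cat.
  rewrite !head_pair // !last_pair // h1 h2 /z1 /z3 /z4 !head_zig !last_zig.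
  clear X Y z1 z3 z4 nX nY nz1 nz3 nz4 nr1.
  have -> : false (+) odd (8 * j + 5) = true by lia.
  have -> : false (+) odd (2 * j - 1) = true by lia.
  have -> : true (+) odd (2 * j) = true by lia.
  rewrite !quot_crossC !quot_cross ?quot_reflections; [|lia ..].
  (* This link wraps around, so it restores [m - d] and leaves [d = 4j + 3] out. *)
  rewrite (_ : (4 * l - (2 * j - 1)./2 <= 4 * l - j - (8 * j + 5)./2) = false); last lia.
  rewrite !(count_cat, count_mem_cons) !count_quots_rev ?alternating_zig //.
  case: t tc => [_|c0].
    rewrite !count_quots_zig ?count_quots_pair ?add0n; [|lia ..].
    rewrite !xpair_eqE.
    apply: leq_trans (leq_b1 (c < 4 * l + 1)).
    rewrite /absdiff in e; rewrite eqxx !andTb ?addn0 {sc sq}.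
    disjoint_intervals [:: (2 * l - (4 * j + 2), 2 * l + (4 * j + 3)); (4 * l - 2 * j + 1, 4 * l); (0, 1);
      (last 0 s1 + 2 * l - head 0 s2, (last 0 s1 + 2 * l - head 0 s2).+1);
      (3 * l + j + 2, 3 * l + j + 3); (1, 2 * j + 1); (4 * l, (4 * l).+1);
      (head 0 s2 + 2 * l - last 0 s1, (head 0 s2 + 2 * l - last 0 s1).+1)].
  rewrite !count_quots_zig_rot.
  by rewrite !xpair_eqE; have := sq c; move: c0 hc => /= c0 hc; lia.
Qed.

(** Decidable conditions, so that explicit small paths are checked by evaluation. *)
Lemma good_pathP l s x : size s = 8 * l + 1 -> uniq s -> uniq (x :: quots l s) ->
  all (fun p => p.2 < 4 * l + 1) s -> good_path l s x.
Proof.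
move=> sz us uq hs; split=> // [t v|t c _ _]; rewrite count_uniq_mem //; last exact: leq_b1.
by case: (boolP (_ \in _)) => // /(allP hs) /= ->.
Qed.

(** For [l = 1] there is no even [d] with [0 < d < 2l]. *)
Lemma good_path_m5 : good_path 1
  [:: (false, 0); (true, 0); (true, 2); (false, 1); (true, 3); (false, 4); (false, 3); (true, 1);
      (true, 4)] (false, 1).
Proof. exact: good_pathP. Qed.

(** The case [3d = m] with [j = 0], where the ends [1] and [l.-1] used above coincide. *)
Lemma good_path_m9 : good_path 2
  [:: (false, 0); (false, 1); (true, 4); (false, 4); (true, 2); (true, 7); (false, 2); (false, 7);
      (true, 8); (false, 6); (true, 5); (true, 3); (false, 8); (false, 5); (false, 3); (true, 0);
      (true, 1)] (false, 3).
Proof. exact: good_pathP. Qed.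

(** * Realization in the dihedral group *)

Section Dihedral.

Import GroupScope.

Definition dihedral_gens (gT : finGroupType) (m : nat) (u v : gT) :=
  [/\ #[u] = m, v \notin <[u]>, v ^+ 2 = 1 & u ^ v = u^-1].

Definition elt (gT : finGroupType) (u v : gT) (p : bool * nat) := u ^+ p.2 * v ^+ p.1.

Lemma elt_inj (gT : finGroupType) m (u v : gT) : dihedral_gens m u v ->
  {in [pred p | p.2 < m] &, injective (elt u v)}.
Proof.
case=> om nuv v2 uv [s a] [t b]; rewrite !inE /elt /= => ha hb.
have h (x y : nat) : u ^+ x * v = u ^+ y -> false.
  by move/(canRL (mulKg _)) => e; move: nuv; rewrite e groupM ?groupV ?mem_cycle.
case: s; case: t; rewrite ?mulg1 => e.
- by move/mulIg/eqP: e; rewrite eq_expg_mod_order om !modn_small // => /eqP->.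
- by have := h _ _ e.
- by have := h _ _ (esym e).
- by move/eqP: e; rewrite eq_expg_mod_order om !modn_small // => /eqP->.
Qed.

(** Conjugation by [v] inverts [u], hence the reversed sign in [quot] for steps leaving a
    reflection. *)
Lemma elt_quot (gT : finGroupType) l (u v : gT) p q : dihedral_gens (4 * l + 1) u v ->
  p.2 <= 4 * l -> q.2 <= 4 * l ->
  (elt u v (p.1, pos l p))^-1 * elt u v (q.1, pos l q) = elt u v (quot l p q).
Proof.
case=> om nuv v2 uv hp hq.
have uM k : u ^+ (k %% (4 * l + 1)) = u ^+ k by rewrite -om expg_mod_order.
have u2m : u ^+ (2 * (4 * l + 1)) = 1 by rewrite mulnC expgM -om expg_order expg1n.
have uB (x y : nat) : y <= 2 * (4 * l + 1) -> u ^+ (x + 2 * (4 * l + 1) - y) = (u ^+ y)^-1 * u ^+ x.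
  move=> hy; apply: (canRL (mulKg _)); rewrite -expgD addnBCA; last lia.
    by rewrite subnn addn0 expgD u2m mulg1.
  lia.
have hP r : r.2 <= 4 * l -> pos l r <= 2 * (4 * l + 1) by rewrite /pos; case: r => [[] ?] /=; lia.
have conjv k : (u ^+ k) ^ v = (u ^+ k)^-1 by rewrite conjXg uv expgVn.
have uv_swap k : u ^+ k * v = v * (u ^+ k)^-1 by rewrite conjgC conjv.
have vu_swap k : v * u ^+ k = (u ^+ k)^-1 * v by rewrite [RHS]conjgC conjVg conjv invgK.
have vV : v^-1 = v by apply/eqP; rewrite eq_invg_mul -expg2 v2.
have uC j k : u ^+ j * (u ^+ k)^-1 = (u ^+ k)^-1 * u ^+ j.
  by apply/commuteV/commuteX2.
rewrite /elt /quot /=; move: (hP p hp) (hP q hq).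
case: p hp => [s a] /= hp; case: q hq => [t b] /= hq.
set x := pos l _; set y := pos l _ => hx hy; rewrite uM; case: s @x hx => x hx.
  rewrite uB // expg1 uv_swap invMg invgK vV -mulgA (mulgA v) vu_swap !mulgA uC -!mulgA.
  by congr (_ * (_ * _)); case: (t); rewrite ?mulg1 // -expg2 v2.
by rewrite uB // mulg1 mulgA.
Qed.

Lemma mod_sub_eq0 m x y : x < y + m -> y < x + m -> (x + 2 * m - y) %% m = 0 -> x = y.
Proof.
move=> h1 h2; case: (leqP y x) => hyx.
  by rewrite (_ : _ - _ = 2 * m + (x - y)) ?modnMDl ?modn_small; lia.
by rewrite (_ : _ - _ = 1 * m + (x + m - y)) ?modnMDl ?modn_small; lia.
Qed.

Lemma quots_nontriv l s : uniq s -> all (fun p => p.2 <= 4 * l) s -> (false, 0) \notin quots l s.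
Proof.
case: s => // p s; elim: s p => // q s IHs p /andP[npq us] /andP[hp hs].
rewrite /= inE negb_or IHs // andbT.
have /andP[hq _] := hs.
apply: contra npq; rewrite /quot inE xpair_eqE => /andP[].
case: p hp => [t a]; case: q hq {IHs us hs} => [u b] /= hb ha htu.
have -> : u = t by case: u t htu => [] [].
move=> /eqP/esym h; suff -> : a = b by rewrite eqxx.
by case: t h {htu}; rewrite /pos /= => /mod_sub_eq0 h; lia.
Qed.

Lemma uniq_count_le1 (T : eqType) (s : seq T) : (forall x, count_mem x s <= 1) -> uniq s.
Proof.
move=> h; apply: count_mem_uniq => x; have := h x.
by rewrite -has_pred1 has_count; case: (count_mem x s) => [|[]].
Qed.

Lemma take_prod (gT : finGroupType) (h : gT) s i : i <= size s ->
  (\prod_(g <- take i (pairmap (fun x y => x^-1 * y) h s)) g) = h^-1 * nth 1 (h :: s) i.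
Proof.
elim: s h i => [|k s IHs] h [|i] //= hi; rewrite ?take0 ?big_nil ?mulVg //.
by rewrite big_cons IHs //= -mulgA mulKVg.
Qed.

(** By telescoping; left translation being injective, distinct vertices give distinct partial
    products. *)
Lemma partial_prods_pairmap (gT : finGroupType) (h : gT) s :
  partial_prods (pairmap (fun x y => x^-1 * y) h s) = map (mulg h^-1) (h :: s).
Proof.
apply: (@eq_from_nth _ 1); first by rewrite !size_map size_iota size_pairmap.
rewrite size_map size_iota size_pairmap => i hi.
by rewrite [LHS](nth_map 0) ?size_iota ?size_pairmap // nth_iota // add0n take_prod // (nth_map 1).
Qed.

(** The [8l] quotients are distinct and avoid [1] and the omitted element, whose complement is [S];
    by cardinality they exhaust [S]. *)
Lemma sequencing_of_path (gT : finGroupType) l (u v : gT) (s : seq (bool * nat)) x (S : {set gT}) :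
  dihedral_gens (4 * l + 1) u v -> good_path l s x -> x.2 <= 4 * l ->
  elt u v x \notin S -> 1 \notin S -> #|S| = (8 * l)%N -> #|gT| = (8 * l + 2)%N ->
  x != (false, 0) -> exists s', S_sequencing S s'.
Proof.
move=> huv [sz hs hq] hx xS oneS cS cG x0.
have us : uniq s by apply: uniq_count_le1 => -[t a]; apply: leq_trans (hs t a) (leq_b1 _).
have all_s : all (fun p => p.2 <= 4 * l) s.
  apply/allP=> -[t a] hta /=; have := hs t a.
  by rewrite count_uniq_mem // hta addn1 ltnS; case: (a <= 4 * l).
have qlt : all (fun p => p.2 < 4 * l + 1) (quots l s).
  case: (s) => // p s0; elim: s0 p => //= q s0 IHs p; rewrite IHs andbT ltn_mod; lia.
have uq : uniq (x :: quots l s).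
  apply: uniq_count_le1 => -[t c].
  case: (leqP c (4 * l)) => hc; last first.
    rewrite leq_eqVlt ltnS leqn0 (_ : count_mem _ _ = 0) //; apply/count_memPn.
    rewrite inE negb_or; apply/andP; split.
      by apply: contraTneq hx => <- /=; rewrite -ltnNge.
    by apply: contraL hc => /(allP qlt); rewrite addn1 ltnS -leqNgt.
  case: (boolP (t || (0 < c))) => [|]; first exact: hq.
  rewrite negb_or -leqNgt leqn0 => /andP[/negbTE-> /eqP->].
  by rewrite (_ : count_mem _ _ = 0) //; apply/count_memPn; rewrite inE negb_or eq_sym x0 quots_nontriv.
have eltpos p : elt u v (p.1, pos l p) = elt u v (p.1, pos l p %% (4 * l + 1)).
  by case: huv => om _ _ _; rewrite /elt -[in RHS]om expg_mod_order.
pose f p := elt u v (p.1, pos l p).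
case: s => [|p s] in sz hs hq us all_s uq qlt *; first by move: sz; rewrite /= addn1.
have S'E : pairmap (fun x y => x^-1 * y) (f p) (map f s) = map (elt u v) (quots l (p :: s)).
  rewrite /f /= {sz hs hq us uq qlt}; elim: s p all_s => //= q s IHs p /and3P[hp hq hs].
  by rewrite elt_quot // IHs //= hq.
set S' := pairmap _ _ _ in S'E.
have finj : {in [pred p | p.2 <= 4 * l] &, injective f}.
  move=> [t a] [t' a']; rewrite !inE /f => ha ha'; rewrite (eltpos (t, a)) (eltpos (t', a')).
  move/(elt_inj huv); rewrite !inE /= !ltn_mod addn1 => /(_ isT isT) [-> e].
  by move/eqP: e; rewrite /pos /= eqn_modDr !modn_small ?addn1 ?ltnS // => /eqP->.
exists S'; apply/andP; split; last first.
  rewrite partial_prods_pairmap map_inj_uniq; last exact: mulgI.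
  rewrite -map_cons map_inj_in_uniq // => a b ha hb.
  by apply: finj; [apply: (allP all_s)|apply: (allP all_s)].
have uS' : uniq S'.
  rewrite S'E map_inj_in_uniq; first by case/andP: uq.
  by move=> a b ha hb; apply: (elt_inj huv); [apply: (allP qlt)|apply: (allP qlt)].
have elt0 : elt u v (false, 0) = 1 by rewrite /elt mulg1.
have SE : S = ~: [set 1; elt u v x].
  apply/eqP; rewrite eqEcard; apply/andP; split.
    apply/subsetP => g gS; rewrite !inE negb_or; apply/andP; split.
      by apply: contraNneq oneS => <-.
    by apply: contraNneq xS => <-.
  have nx : 1 != elt u v x.
    rewrite -elt0; apply/eqP => /(elt_inj huv); rewrite !inE !addn1 !ltnS => /(_ isT hx) e.
    by rewrite -e eqxx in x0.
  have := cardsC [set 1; elt u v x]; rewrite cards2 nx cG cS => e.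
  by rewrite -(leq_add2l 2) e addnC.
apply: uniq_perm => //; first exact: enum_uniq.
have sub : {subset S' <= enum S}.
  move=> g; rewrite S'E => /mapP[q hq' ->]; rewrite mem_enum SE !inE negb_or.
  apply/andP; split; apply/eqP.
    rewrite -elt0 => /(elt_inj huv); rewrite !inE (allP qlt _ hq') => /(_ isT) h.
    by move: hq'; rewrite h ?addn1 // => h'; move: (quots_nontriv us all_s); rewrite h'.
  move/(elt_inj huv); rewrite !inE (allP qlt _ hq') => /(_ isT) h.
  by case/andP: uq => /negP[]; rewrite -h // addn1 ltnS.
apply: (uniq_min_size uS' sub _).2 => //.
by rewrite -cardE cS S'E size_map /= size_pairmap; move: sz; rewrite /= addn1 => -[->].
Qed.

(** * Dihedral generators and their changes *)

Lemma dihedral_gens_exist m : 1 < m ->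
  exists u v : 'D_m.*2, dihedral_gens m u v /\ forall x, exists i (s : bool), x = u ^+ i * v ^+ s.
Proof.
move=> m1; have [_] := isoGrpP _ (Grp_dihedral m1) (isog_refl 'D_m.*2).
case/existsP=> -[u v] /= /eqP[defG um v2 uv]; exists u, v.
have {}defG : <[u]> * <[v]> = 'D_m.*2.
  by rewrite -norm_joinEr // norms_cycle uv groupV cycle_id.
have cG := card_dihedral m1.
have uD : #[u] <= m by apply: dvdn_leq; [lia|rewrite order_dvdn um].
have vD : #[v] <= 2 by rewrite dvdn_leq // order_dvdn v2.
have nuv : v \notin <[u]>.
  apply/negP=> vu; move: cG; rewrite -defG mulGSid ?cycle_subG // -orderE => e.
  by move: uD; rewrite e; lia.
have decomp x : exists i (s : bool), x = u ^+ i * v ^+ s.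
  have : x \in 'D_m.*2 by rewrite inE.
  rewrite -defG => /mulsgP[_ _ /cycleP[i ->] /cycleP[j ->] ->]; exists i, (odd j).
  by rewrite -{1}(odd_double_half j) -(mul2n j./2) expgD expgM v2 expg1n mulg1.
split=> //; split=> //.
(* Since [#[v] <= 2], this forces [#[u] = m]. *)
have : m.*2 <= #[u] * #[v].
  by rewrite !orderE mul_cardG defG cG leq_pmulr ?cardG_gt0.
by move/leq_trans/(_ (leq_mul (leqnn _) vD)) ; rewrite muln2 leq_double => h; apply/eqP; rewrite eqn_leq uD.
Qed.

Lemma dihedral_gens_exp (gT : finGroupType) m (u v : gT) a : dihedral_gens m u v ->
  coprime m a -> dihedral_gens m (u ^+ a) v.
Proof.
case=> om nuv v2 uv co.
have gen : generator <[u]> (u ^+ a) by rewrite generator_coprime om.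
split=> //; first by rewrite orderE -(eqP gen) -orderE.
  by rewrite -(eqP gen).
by rewrite conjXg uv expgVn.
Qed.

Lemma dihedral_gens_reflection (gT : finGroupType) m (u v : gT) a : dihedral_gens m u v ->
  dihedral_gens m u (u ^+ a * v).
Proof.
case=> om nuv v2 uv.
have comm : u ^ (u ^+ a) = u by apply/conjg_fixP/commgP/commuteX.
split=> //; first by rewrite groupMl ?mem_cycle.
  by rewrite expg2 {1}(conjgC (u ^+ a) v) conjXg uv expgVn -mulgA mulKg -expg2.
by rewrite conjgM comm.
Qed.

(** * Reduction of the omitted rotation by changing [u] *)

Section Reachable.

Variables (gT : finGroupType) (l : nat) (v : gT).
Hypothesis gv : gvozdjak_conjecture.
Hypothesis l0 : 0 < l.

(** Quantifying over [u] lets successive changes of generator compose. *)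
Definition reachable d := forall u, dihedral_gens (4 * l + 1) u v ->
  exists w d' s, [/\ dihedral_gens (4 * l + 1) w v, w ^+ d' = u ^+ d,
    0 < d' <= 4 * l & good_path l s (false, d')].

Lemma reachable_good d s : 0 < d <= 4 * l -> good_path l s (false, d) -> reachable d.
Proof. by move=> hd gs u gu; exists u, d, s. Qed.

(** [u ^+ (2l + 1)] is a square root of [u], because [2 (2l + 1) = m + 1]. *)
Lemma reachable_double d : reachable (2 * d) -> reachable d.
Proof.
move=> h u gu; have [om _ _ _] := gu.
have co : coprime (4 * l + 1) (2 * l + 1).
  apply: coprime_dvdr (coprimenS _).
  by apply/dvdnP; exists 2; lia.
have [w [d' [s [gw e hd gs]]]] := h _ (dihedral_gens_exp gu co).
exists w, d', s; split=> //; rewrite e -expgM.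
rewrite (_ : ((2 * l + 1) * (2 * d) = (4 * l + 1) * d + d)%N); last lia.
by rewrite expgD expgM -om expg_order expg1n mul1g.
Qed.

(** Replaces [u] by its inverse, written [u ^+ (4l)]. *)
Lemma reachable_opp d : d <= 4 * l + 1 -> reachable (4 * l + 1 - d) -> reachable d.
Proof.
move=> dm h u gu; have [om _ _ _] := gu.
have co : coprime (4 * l + 1) (4 * l) by rewrite addn1 coprimeSn.
have [w [d' [s [gw e hd gs]]]] := h _ (dihedral_gens_exp gu co).
exists w, d', s; split=> //; rewrite e -expgM.
apply/eqP; rewrite eq_expg_mod_order om.
rewrite -(eqn_modDr (4 * l + 1 - d)) subnKC // modnn.
by rewrite -[X in _ + X]mul1n -mulnDl addn1 -addn1 modnMr.
Qed.

Lemma reachable_small d : 0 < d < l -> reachable d.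
Proof.
move=> hd; apply: reachable_double; apply: reachable_opp; first lia.
by have [s] := good_path_even gv hd; apply: reachable_good; lia.
Qed.

Lemma reachable_2l : 1 < l -> reachable (2 * l).
Proof.
move=> l1; apply: reachable_double; apply: reachable_opp; first lia.
rewrite (_ : (_ - _ = 1)%N); last lia.
by apply: reachable_small; lia.
Qed.

(* [d -> 4l + 1 - 2d] doubles the distance from [3 d] to [4l + 1]. *)
Lemma reachable_middle n d : 1 < l -> l < d < 2 * l -> 4 * l + 1 < absdiff (3 * d) (4 * l + 1) + n ->
  reachable d.
Proof.
move=> l1; elim: n d => [|n IHn] d hd; first by rewrite /absdiff; lia.
case: (eqVneq (3 * d)%N (4 * l + 1)%N) => [e _|ne hn].
  case: (eqVneq l 2) => [l2|l2].
    have -> : d = 3 by lia.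
    by apply: reachable_good; [lia|rewrite l2; apply: good_path_m9].
  (* [3d = 4l + 1] forces [l] to be 2 modulo 3. *)
  have lj : l = (3 * (l %/ 3) + 2)%N by lia.
  have [s gs] : exists s, good_path l s (false, 4 * (l %/ 3) + 3) by apply: good_path_third => //; lia.
  have -> : d = (4 * (l %/ 3) + 3)%N by lia.
  by apply: reachable_good gs; lia.
apply: reachable_double; apply: reachable_opp; first lia.
case: (ltngtP (4 * l + 1 - 2 * d) l) => h.
- by apply: reachable_small; lia.
- by apply: IHn; first lia; move: hn; rewrite /absdiff; lia.
- by rewrite h; apply/reachable_double/reachable_2l.
Qed.

Lemma reachable_all d : 0 < d <= 4 * l -> reachable d.
Proof.
have half : (forall d', 0 < d' <= 2 * l -> reachable d') -> 0 < d <= 4 * l -> reachable d.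
  move=> h hd; case: (leqP d (2 * l)) => hd2; first by apply: h; lia.
  by apply: reachable_opp; [lia|apply: h; lia].
apply: half => {}d hd.
case: (ltngtP l 1) => l1; first lia; last first.
  have r1 : reachable 1 by apply: reachable_good; [lia|rewrite l1; apply: good_path_m5].
  have r2 : reachable 2.
    apply: (@reachable_double 2); apply: reachable_opp; first lia.
    by rewrite l1; apply: r1.
  by have [->|->] : (d = 1 \/ d = 2)%N by lia.
have r2l := reachable_2l l1.
case: (ltngtP d l) => [dl|ld|->]; first by apply: reachable_small; lia.
  case: (ltngtP d (2 * l)) => [dl2||->] //; last by lia.
  by apply: (@reachable_middle (4 * l + 2)); lia.
exact: reachable_double.
Qed.

End Reachable.

End Dihedral.

Theorem theorem5p3 :
  gvozdjak_conjecture ->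
  forall (l : nat) (S : {set 'D_(8 * l + 2)}), 0 < l ->
    (1%g \notin S) -> #|S| = 8 * l ->
    exists s : seq 'D_(8 * l + 2), S_sequencing S s.
Proof.
move=> gv l; rewrite (_ : (8 * l + 2 = (4 * l + 1).*2)%N); last lia.
move=> S l0 S1 cS.
have m1 : 1 < 4 * l + 1 by lia.
have [u [v [guv decomp]]] := dihedral_gens_exist m1.
have cG : #|('D_(4 * l + 1).*2)%type| = (8 * l + 2)%N.
  by rewrite -cardsT card_dihedral //; lia.
have [x xS x1] : exists2 x, x \notin S & x != 1%g.
  have : 0 < #|~: (1%g |: S)| by move: (cardsC (1%g |: S)); rewrite cardsU1 S1 cS cG; lia.
  by case/card_gt0P=> x; rewrite !inE negb_or => /andP[]; exists x.
have [om _ _ _] := guv.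
have [i [[] xE]] := decomp x.
  have [s gs] := good_path_reflection gv l0.
  (* The new reflection is [u ^+ (i - 1) * v] modulo [m], so [x] becomes [u] times it, matching
     [(true, 1)]. *)
  apply: (sequencing_of_path (dihedral_gens_reflection (i + 4 * l) guv) gs) => //=; first lia.
  rewrite (_ : elt _ _ _ = x) // xE /elt /= expg1 mulgA -expgS.
  congr (_ * _)%g; apply/eqP; rewrite eq_expg_mod_order om.
  by rewrite (_ : (i + 4 * l).+1 = i + (4 * l + 1)) ?modnDr; last lia.
rewrite mulg1 -(expg_mod_order u) om in xE.
have hd : 0 < i %% (4 * l + 1) <= 4 * l.
  have i0 : i %% (4 * l + 1) != 0 by apply: contraNneq x1 => i0; rewrite xE i0.
  have := ltn_pmod i (ltnW m1); lia.
have [w [d [s [gw e hd' gs]]]] := reachable_all gv l0 hd guv.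
apply: (sequencing_of_path gw gs) => //=; first lia.
  by rewrite /elt /= mulg1 e -xE.
by rewrite xpair_eqE /=; lia.
Qed.
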